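(* Let $c>1$ be a real number such that for all $n$, every completely uniform recovering pair $(\mathcal{A}_u,\mathcal{B}_u)$ on a ground set of size $n$ satisfies $|\mathcal{A}_u||\mathcal{B}_u| \leq c^n$. Then for all $n$, every recovering pair $(\mathcal{A},\mathcal{B})$ on a ground set of size $n$ satisfies $|\mathcal{A}||\mathcal{B}| \leq c^n$.
   Context: A pair $(\mathcal{A},\mathcal{B})$ of set systems (families of subsets) on an $n$ element ground set is called a recovering pair if for every $A,A' \in \mathcal{A}$ and $B,B' \in \mathcal{B}$: ($A \setminus B = A' \setminus B'$ implies $A=A'$) and ($B \setminus A = B' \setminus A'$ implies $B=B'$). A recovering pair $(\mathcal{A},\mathcal{B})$ is uniform if there exists $k$ such that $|A|=|B|=k$ for all $A \in \mathcal{A}$ and $B \in \mathcal{B}$; it is completely uniform if it is uniform and $|\mathcal{A}|=|\mathcal{B}|$. *)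

(* Defs.v *)
From mathcomp Require Import all_boot all_order all_algebra.
From mathcomp Require Import reals.

Set Implicit Arguments.
Unset Strict Implicit.
Unset Printing Implicit Defensive.

Section RecoveringPairs.
Variable T : finType.
Implicit Types (calA calB : {set {set T}}) (A B : {set T}).

Definition recovering_pair calA calB : Prop :=
  forall A A' B B',
    A \in calA -> A' \in calA -> B \in calB -> B' \in calB ->
    (A :\: B = A' :\: B' -> A = A') /\ (B :\: A = B' :\: A' -> B = B').

(* The size k is common to both families. *)
Definition uniform calA calB : Prop :=
  exists k : nat,
    (forall A, A \in calA -> #|A| = k) /\ (forall B, B \in calB -> #|B| = k).

Definition uniform_recovering_pair calA calB : Prop :=
  recovering_pair calA calB /\ uniform calA calB.

Definition completely_uniform_recovering_pair calA calB : Prop :=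
  uniform_recovering_pair calA calB /\ #|calA| = #|calB|.

End RecoveringPairs.

(* Main.v *)
(** The bound survives tensor powers, so polynomial losses are free.  On the
    disjoint union of [m] copies of the ground set, the [m]-th power of a
    recovering pair is recovering; restricting each side to its most popular
    set size costs a factor at most [n * m + 1] per side and leaves a pair
    [(A, B)] whose sets have sizes [k] and [l].  The product of [(A, B)] with
    its swap [(B, A)] is completely uniform, with common size [k + l] and
    [|A| |B|] sets on each side.  Hence [(|A| |B|)^m <= (n m + 1)^2 c^(n m)]
    for the original pair and every [m]. *)
Require Import Defs.
From mathcomp Require Import all_boot all_order all_algebra.
From mathcomp Require Import reals.

Import Order.TTheory GRing.Theory Num.Theory.
Local Open Scope ring_scope.

Section DisjointUnion.
Variables T1 T2 : finType.
Implicit Types (X : {set T1}) (Y : {set T2}).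
Implicit Types (F : {set {set T1}}) (G : {set {set T2}}).

Definition set_sum X Y : {set T1 + T2} :=
  [set z | match z with inl x => x \in X | inr y => y \in Y end].

Lemma set_sum_inj X X' Y Y' :
  set_sum X Y = set_sum X' Y' -> X = X' /\ Y = Y'.
Proof.
move/setP=> eqS; split; apply/setP=> z.
- by have := eqS (inl z); rewrite !inE.
- by have := eqS (inr z); rewrite !inE.
Qed.

Lemma set_sumD X X' Y Y' :
  set_sum X Y :\: set_sum X' Y' = set_sum (X :\: X') (Y :\: Y').
Proof. by apply/setP=> -[z|z]; rewrite !inE. Qed.

Lemma card_set_sum X Y : #|set_sum X Y| = (#|X| + #|Y|)%N.
Proof.
rewrite -!sum1_card big_sumType /=; congr (_ + _)%N;
  by apply: eq_bigl => z; rewrite inE.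
Qed.

Definition family_prod F G :=
  [set set_sum p.1 p.2 | p in setX F G].

Lemma family_prodP F G S :
  reflect (exists X Y, [/\ X \in F, Y \in G & S = set_sum X Y])
          (S \in family_prod F G).
Proof.
apply: (iffP imsetP) => [[[X Y]]|[X [Y [XF YG ->]]]].
- by rewrite inE => /andP[XF YG] ->; exists X, Y.
- by exists (X, Y) => //; rewrite inE XF YG.
Qed.

Lemma card_family_prod F G : #|family_prod F G| = (#|F| * #|G|)%N.
Proof.
rewrite card_imset ?cardsX // => -[X Y] [X' Y'] /= eqS.
by have [-> ->] := set_sum_inj _ _ _ _ eqS.
Qed.

(** Set difference acts separately on the two summands, so each component is recovered from its own
    part. *)
Lemma recovering_pair_prod (F1 G1 : {set {set T1}}) (F2 G2 : {set {set T2}}) :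
  recovering_pair F1 G1 -> recovering_pair F2 G2 ->
  recovering_pair (family_prod F1 F2) (family_prod G1 G2).
Proof.
move=> rec1 rec2 A A' B B'.
move=> /family_prodP[A1 [A2 [hA1 hA2 ->]]] /family_prodP[A1' [A2' [hA1' hA2' ->]]].
move=> /family_prodP[B1 [B2 [hB1 hB2 ->]]] /family_prodP[B1' [B2' [hB1' hB2' ->]]].
have [recA1 recB1] := rec1 _ _ _ _ hA1 hA1' hB1 hB1'.
have [recA2 recB2] := rec2 _ _ _ _ hA2 hA2' hB2 hB2'.
rewrite !set_sumD; split=> /set_sum_inj[].
- by move=> /recA1-> /recA2->.
- by move=> /recB1-> /recB2->.
Qed.

End DisjointUnion.

Lemma recovering_pair_sym (T : finType) (F G : {set {set T}}) :
  recovering_pair F G -> recovering_pair G F.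
Proof.
move=> rec B B' A A' hB hB' hA hA'.
by have [? ?] := rec _ _ _ _ hA hA' hB hB'.
Qed.

Lemma recovering_pair_sub (T : finType) (F F' G G' : {set {set T}}) :
  F' \subset F -> G' \subset G -> recovering_pair F G -> recovering_pair F' G'.
Proof.
move=> /subsetP sF /subsetP sG rec A A' B B' /sF hA /sF hA' /sG hB /sG hB'.
exact: rec.
Qed.

Lemma recovering_pair_power (T : finType) (F G : {set {set T}}) (m : nat) :
  recovering_pair F G ->
  exists (U : finType) (F' G' : {set {set U}}),
    [/\ #|U| = (#|T| * m)%N, recovering_pair F' G',
        #|F'| = (#|F| ^ m)%N & #|G'| = (#|G| ^ m)%N].
Proof.
move=> rec; elim: m => [|m [U [F' [G' [cU rec' cF cG]]]]].
(* The empty product: each family is a singleton, matching the value [1] of the zeroth power. *)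
- exists void, [set set0], [set set0].
  rewrite !cards1 card_void muln0; split=> // A A' B B'.
  by rewrite !inE => /eqP-> /eqP-> /eqP-> /eqP->.
- exists (T + U)%type, (family_prod _ _ F F'), (family_prod _ _ G G').
  rewrite !card_family_prod card_sum cU cF cG mulnS !expnS.
  by split=> //; apply: recovering_pair_prod.
Qed.

(** Pigeonhole over the [#|T|.+1] possible sizes [0, ..., #|T|]. *)
Lemma popular_card (T : finType) (F : {set {set T}}) :
  exists k, (#|F| <= #|T|.+1 * #|[set A in F | #|A| == k]|)%N.
Proof.
pose f (k : 'I_#|T|.+1) := #|[set A in F | #|A| == k]|.
have [k maxk] : {k | (\max_i f i)%N = f k}.
  by have [|k maxk] := @bigop.eq_bigmax _ f; [rewrite card_ord | exists k].
exists (k : nat); have -> : #|F| = (\sum_i f i)%N.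
  rewrite -[LHS]sum1_card.
  (* [inord] never falls back to its default here, since [#|A| <= #|T|]. *)
  rewrite (partition_big (fun A : {set T} => inord #|A| : 'I_#|T|.+1) xpredT) //=.
  apply: eq_bigr => i _; rewrite /f -[RHS]sum1_card; apply: eq_bigl => A.
  by rewrite !inE -val_eqE /= inordK // ltnS max_card.
rewrite -/(f k) -maxk -[X in (_ <= X * _)%N]card_ord -sum_nat_const.
by apply: leq_sum => i _; apply: bigop.leq_bigmax.
Qed.

Lemma swap_completely_uniform (T : finType) (F G : {set {set T}}) (k l : nat) :
  recovering_pair F G ->
  (forall A, A \in F -> #|A| = k) -> (forall B, B \in G -> #|B| = l) ->
  completely_uniform_recovering_pair (family_prod _ _ F G) (family_prod _ _ G F).
Proof.
move=> rec cF cG; split; last by rewrite !card_family_prod mulnC.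
split; first exact: (recovering_pair_prod _ _ _ _ _ _ rec (recovering_pair_sym _ _ _ rec)).
exists (k + l)%N; split=> S /family_prodP[X [Y [hX hY ->]]];
  rewrite card_set_sum.
- by rewrite (cF _ hX) (cG _ hY).
- by rewrite (cG _ hX) (cF _ hY) addnC.
Qed.

(** If [x > 1], its powers outgrow any quadratic; taking exponent [m * 3] makes the linear Bernoulli
    bound suffice. *)
Lemma le1_of_expr_le_square (R : archiRealFieldType) (x : R) (n : nat) :
  (forall m, x ^+ m <= (n * m).+1%:R ^+ 2) -> x <= 1.
Proof.
move=> bnd; rewrite leNgt; apply/negP => x_gt1.
pose h := x - 1; have h_gt0 : 0 < h by rewrite subr_gt0.
have x_ge0 : 0 <= x by rewrite (le_trans ler01) // ltW.
(* Chosen so that [K * m%:R ^+ 2] dominates the hypothesis at exponent [m * 3]: for [m >= 1],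
   [n * (m * 3) + 1 <= (n * 3 + 1) * m]. *)
pose K : R := (n * 3).+1%:R ^+ 2.
(* Large enough to refute [m%:R * h ^+ 3 <= K]; the successor ensures [m >= 1]. *)
pose m := (Num.bound (K / h ^+ 3)).+1.
have m_gt0 : 0 < m%:R :> R by rewrite ltr0n.
have bern : m%:R * h <= x ^+ m.
  elim: (m) => [|p IH]; first by rewrite mul0r expr0 ler01.
  have xp_ge1 : 1 <= x ^+ p by rewrite exprn_ege1 // ltW.
  (* With [x = h + 1], the next power is [h * x ^+ p + x ^+ p], and [h <= h * x ^+ p]. *)
  rewrite exprS -{1}[x](subrK 1) -/h (mulrDl h) -natr1 mulrDl !mul1r.
  by rewrite addrC lerD // ler_peMr // ltW.
(* Cubing Bernoulli's inequality beats the quadratic bound. *)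
have cube : (m%:R * h) ^+ 3 <= K * m%:R ^+ 2.
  apply: (@le_trans _ _ (x ^+ (m * 3))).
    by rewrite exprM lerXn2r ?nnegrE ?exprn_ge0 ?mulr_ge0 ?(ltW h_gt0).
  apply: (le_trans (bnd _)); rewrite /K -exprMn lerXn2r ?nnegrE ?mulr_ge0 //.
  by rewrite -natrM ler_nat mulSn [(m * 3)%N]mulnC mulnA addnC -addn1 leq_add2l.
have : m%:R * h ^+ 3 <= K.
  rewrite -(ler_pM2r (exprn_gt0 2 m_gt0)); apply: le_trans cube.
  by rewrite exprMn mulrAC -exprS.
rewrite -ler_pdivlMr ?exprn_gt0 // leNgt => /negP[].
have K_ge0 : 0 <= K / h ^+ 3 by rewrite divr_ge0 ?exprn_ge0 // ltW.
have := archi_boundP K_ge0; move/lt_trans; apply.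
by rewrite ltr_nat.
Qed.

Theorem lemma6 (R : realType) (c : R) (c_gt1 : 1 < c)
  (bound_cu : forall (n : nat) (T : finType) (Au Bu : {set {set T}}),
     #|T| = n -> completely_uniform_recovering_pair Au Bu ->
     (#|Au| * #|Bu|)%:R <= c ^+ n) :
  forall (n : nat) (T : finType) (calA calB : {set {set T}}),
    #|T| = n -> recovering_pair calA calB ->
    (#|calA| * #|calB|)%:R <= c ^+ n.
Proof.
move=> n T calA calB cT rec.
have c_gt0 : 0 < c by apply: lt_trans c_gt1.
(* Normalise to the ratio of [#|calA| * #|calB|] to [c ^+ n], whose powers are to be bounded
   polynomially. *)
rewrite -[leRHS]mul1r -ler_pdivrMr ?exprn_gt0 //.
apply: (@le1_of_expr_le_square _ _ n) => m.
rewrite expr_div_n ler_pdivrMr ?exprn_gt0 // -exprM.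
have [U [F [G [cU recU cF cG]]]] := recovering_pair_power _ _ _ m rec.
have [k popk] := popular_card _ F; have [l popl] := popular_card _ G.
set Fk := [set A in F | _] in popk; set Gl := [set A in G | _] in popl.
have recS : recovering_pair Fk Gl.
  by apply: recovering_pair_sub recU; apply/subsetP=> A; rewrite inE => /andP[].
have cu : completely_uniform_recovering_pair
    (family_prod _ _ Fk Gl) (family_prod _ _ Gl Fk).
  apply: (swap_completely_uniform _ _ _ k l) => // A.
  - by rewrite inE => /andP[_ /eqP].
  - by rewrite inE => /andP[_ /eqP].
have le_sub : (#|Fk| * #|Gl|)%:R <= c ^+ (n * m).
  (* The ground set [U + U] has [2 * n * m] points, so the hypothesis bounds the square of
     [#|Fk| * #|Gl|] by the square of [c ^+ (n * m)]; take roots. *)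
  have := bound_cu _ _ _ _ erefl cu.
  rewrite !card_family_prod [(#|Gl| * _)%N]mulnC card_sum cU cT addnn -muln2.
  by rewrite exprM natrM -expr2 ler_pXn2r // nnegrE ?ler0n // exprn_ge0 // ltW.
apply: le_trans (ler_wpM2l (exprn_ge0 2 (ler0n R _)) le_sub).
(* One factor [(n * m).+1] pays for each of [popk] and [popl]. *)
rewrite -!natrX -natrM ler_nat expnMn -cF -cG.
by rewrite -mulnn mulnACA -cT -cU leq_mul.
Qed.
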